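(* Let $n$ be a positive integer, let $S$ be a bipotent semiring, let $X \subseteq M_n(S)$ be a finite set, and let $T = \langle X \rangle$ be the subsemigroup of $M_n(S)$ generated by $X$. If the growth function of the subsemigroup of $(S,\cdot)$ generated by the entries of the matrices in $X$ is bounded above by a polynomial of degree $t \in \mathbb{N}_0$, then the growth function of $T$ is bounded above by a polynomial of degree $tn^2$.
   Context: $\mathbb{N}$ is the set of positive integers and $\mathbb{N}_0$ the set of non-negative integers. A semiring $S$ is a set with two operations $+,\cdot$ such that $(S,+)$ is a commutative monoid with identity $0_S$, $(S,\cdot)$ is a monoid with identity $1_S$, multiplication distributes over addition on both sides, and $x0_S = 0_Sx = 0_S$ for all $x$. $S$ is bipotent if $x+y\in\{x,y\}$ for all $x,y\in S$. $M_n(S)$ is the monoid of all $n\times n$ matrices over $S$ under matrix multiplication. For a semigroup generated by a finite set $X$, its growth function with respect to $X$ is $f_X(k) = |\bigcup_{i=1}^k X^i|$ for $k\in\mathbb{N}$, where $X^i$ is the set of products of $i$ elements of $X$. It is bounded above by a polynomial of degree $m$ if there is $c_X>0$ such that $f_X(k)\le c_Xk^m$ for all $k\in\mathbb{N}$. This property does not depend on the choice of finite generating set, so one says that the growth function of the semigroup is bounded above by a polynomial of degree $m$ without reference to a generating set. *)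

(* Defs.v *)
From HB Require Import structures.
From mathcomp Require Import all_boot all_order all_algebra finmap.
From mathcomp Require Import classical_sets reals.

Set Implicit Arguments.
Unset Strict Implicit.
Unset Printing Implicit Defensive.

Import Order.TTheory GRing.Theory Num.Theory.
Local Open Scope fset_scope.
Local Open Scope classical_set_scope.
Local Open Scope ring_scope.

Definition bipotent (S : pzSemiRingType) : Prop :=
  forall x y : S, x + y = x \/ x + y = y.

Definition entries (S : pzSemiRingType) (n : nat) (X : set 'M[S]_n) : set S :=
  [set a | exists2 A, X A & exists i j, a = A i j].

Definition subsemigroup_closed (T : choiceType) (op : SemiGroup.law T)
    (A : set T) : Prop :=
  forall x y, A x -> A y -> A (op x y).

(* No unit is added to G: products are over nonempty words, and the
   subsemigroup generated by the empty set is empty. *)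
Definition subsemigroup_gen (T : choiceType) (op : SemiGroup.law T)
    (G : set T) : set T :=
  smallest (subsemigroup_closed op) G.

(* Exponents are shifted by one: [products op X i] is the set X^(i+1) of
   products of i+1 elements of X. *)
Definition products (T : choiceType) (op : SemiGroup.law T)
    (X : {fset T}) (i : nat) : {fset T} :=
  iter i (fun A : {fset T} => [fset op a x | a in A, x in X]) X.

Definition growth (T : choiceType) (op : SemiGroup.law T)
    (X : {fset T}) (k : nat) : nat :=
  #|` (\bigcup_(i <- iota 0 k) products op X i)%fset|.

Definition growth_bounded_wrt (R : realType) (T : choiceType)
    (op : SemiGroup.law T) (X : {fset T}) (m : nat) : Prop :=
  exists2 c : R, 0 < c &
    forall k : nat, (0 < k)%N -> (growth op X k)%:R <= c * k%:R ^+ m.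

(* A property of the subsemigroup U; by [poly_growthP] the choice of the finite
   generating set is irrelevant. *)
Definition poly_growth (R : realType) (T : choiceType)
    (op : SemiGroup.law T) (U : set T) (m : nat) : Prop :=
  exists2 X : {fset T}, subsemigroup_gen op [set` X] = U &
    growth_bounded_wrt R op X m.

Lemma growthP (T : choiceType) (op : SemiGroup.law T) (X : {fset T}) k z :
  reflect (exists2 i, (i < k)%N & z \in products op X i)
          (z \in (\bigcup_(i <- iota 0 k) products op X i)%fset).
Proof.
apply: (iffP (bigfcupP _ _ _ _)) => [[i]|[i ik zi]]; last first.
  by exists i; rewrite ?mem_iota ?add0n ?ik.
by rewrite mem_iota add0n andbT => ik zi; exists i.
Qed.

Lemma productsM (T : choiceType) (op : SemiGroup.law T) (X : {fset T}) i j a b :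
  a \in products op X i -> b \in products op X j ->
  op a b \in products op X (i + j).+1.
Proof.
move=> ai; elim: j b => [|j IHj] b bj.
  by rewrite addn0; apply/imfset2P; exists a => //; exists b.
have /imfset2P[c /= cj [x /= xX ->]] := bj.
rewrite SemiGroup.opA addnS; apply/imfset2P; exists (op a c) => /=.
  exact: IHj.
by exists x.
Qed.

Lemma subsemigroup_gen_products (T : choiceType) (op : SemiGroup.law T)
    (X : {fset T}) z :
  subsemigroup_gen op [set` X] z -> exists i, z \in products op X i.
Proof.
apply: (@smallest_sub _ (subsemigroup_closed op) [set` X]
  [set z | exists i, z \in products op X i]) => [x y [i xi] [j yj]|x xX].
  by exists (i + j).+1; exact: productsM.
by exists 0%N.
Qed.

Lemma growth_change_gen (T : choiceType) (op : SemiGroup.law T)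
    (X Y : {fset T}) :
  [set` Y] `<=` subsemigroup_gen op [set` X] ->
  exists2 N, (0 < N)%N & forall k, (growth op Y k <= growth op X (N * k))%N.
Proof.
move=> YX.
have [N N0 HN] : exists2 N, (0 < N)%N &
    forall y, y \in (Y : seq T) -> exists2 i, (i < N)%N & y \in products op X i.
  have : forall y, y \in (Y : seq T) -> exists i, y \in products op X i.
    by move=> y yY; exact: subsemigroup_gen_products (YX _ yY).
  elim: (Y : seq T) => [|y s IHs] Hs; first by exists 1%N.
  have [|N N0 HN] := IHs; first by move=> x xs; apply: Hs; rewrite inE xs orbT.
  have [i yi] := Hs y (mem_head _ _).
  exists (maxn N i.+1) => [|x]; first by rewrite leq_max N0.
  rewrite inE => /orP[/eqP->|/HN[l lN xl]].
    by exists i => //; rewrite leq_max leqnn orbT.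
  by exists l => //; rewrite leq_max lN.
exists N => // k; apply: fsubset_leq_card; apply/fsubsetP => z.
move=> /growthP[j jk zj]; apply/growthP.
suff [i ij zi] : exists2 i, (i < N * j.+1)%N & z \in products op X i.
  by exists i => //; apply: leq_trans ij _; rewrite leq_mul2l jk orbT.
elim: j z zj {jk} => [|j IHj] z zj; first by rewrite muln1; exact: HN.
have /imfset2P[a /= /IHj[i ij ai] [y /= /HN[l lN yl] ->]] := zj.
exists (i + l).+1; last exact: productsM.
by rewrite mulnS addnC -addnS -addSn leq_add // ltnW.
Qed.

Lemma poly_growthP (R : realType) (T : choiceType) (op : SemiGroup.law T)
    (X : {fset T}) (m : nat) :
  poly_growth R op (subsemigroup_gen op [set` X]) m <->
  growth_bounded_wrt R op X m.
Proof.
split=> [[Y YX [c c0 Hc]]|]; last by exists X.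
have [|N N0 HN] := @growth_change_gen T op Y X.
  by rewrite YX; exact: sub_smallest.
exists (c * N%:R ^+ m) => [|k k0]; first by rewrite mulr_gt0 ?exprn_gt0 ?ltr0n.
apply: (@le_trans _ _ (growth op Y (N * k))%:R); first by rewrite ler_nat.
by rewrite -mulrA -exprMn -natrM Hc // muln_gt0 N0.
Qed.

(* Main.v *)
Require Import Defs.
From mathcomp Require Import all_boot all_order all_algebra finmap.
From mathcomp Require Import classical_sets reals.

Import Order.TTheory GRing.Theory Num.Theory.
Local Open Scope classical_set_scope.
Local Open Scope ring_scope.

(** In a bipotent semiring a nonempty sum equals one of its summands.  An entry
of a product of [i] matrices from [X] is a nonempty sum of products of [i]
entries of matrices in [X] (nonempty because [n > 0]), hence is itself one such
product: [products_entry].  A matrix of length at most [k] in the generators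
[X] therefore has all its [n ^ 2] entries among the [growth E k] elements of
length at most [k] in the entries [E], and there are [growth E k ^ (n ^ 2)]
matrices of that kind ([card_fset_mx]).  If [growth E k <= c * k ^ t], the
count is at most [c ^ (n ^ 2) * k ^ (t * n ^ 2)]. *)

Lemma bipotent_sum (S : pzSemiRingType) (I : eqType) (r : seq I) (F : I -> S) :
  bipotent S -> r != [::] -> exists2 i, i \in r & \sum_(j <- r) F j = F i.
Proof.
move=> bipS; elim: r => // i [|j r] IHr _.
  by exists i; rewrite ?mem_head // big_seq1.
have [//|l lr sumE] := IHr; rewrite big_cons sumE.
have [-> | ->] := bipS (F i) (F l); first by exists i; rewrite ?mem_head.
by exists l; rewrite // inE lr orbT.
Qed.

(** [growth] takes a finite set of generators, whereas [entries] is only a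
predicate. *)
Definition fset_entries {S : pzSemiRingType} {n : nat} (X : {fset 'M[S]_n}) :
    {fset S} :=
  (\bigcup_(A <- X) [fset A ij.1 ij.2 | ij in [set: 'I_n * 'I_n]%SET])%fset.

Lemma fset_entriesE (S : pzSemiRingType) (n : nat) (X : {fset 'M[S]_n}) :
  entries [set` X] = [set` fset_entries X].
Proof.
apply/seteqP; split=> [a [A AX [i [j ->]]] | a /= /bigfcupP[A]].
  apply/bigfcupP; exists A; first by rewrite andbT.
  by apply/imfsetP; exists (i, j) => //=; rewrite finset.in_setT.
by rewrite andbT => AX /imfsetP[[i j] _ ->]; exists A => //; exists i, j.
Qed.

(** Length is preserved exactly: the induction multiplies by one generator on
the right, which turns each entry into a sum, over the [n] inner indices, of
words one letter longer; bipotence selects one of these words. *)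
Lemma products_entry (S : pzSemiRingType) (n : nat) (X : {fset 'M[S]_n})
    (i : nat) (M : 'M[S]_n) (a b : 'I_n) :
  bipotent S -> M \in products (@GRing.mul 'M[S]_n) X i ->
  M a b \in products (@GRing.mul S) (fset_entries X) i.
Proof.
move=> bipS; have XE A c d : A \in X -> A c d \in fset_entries X.
  move=> AX; apply/bigfcupP; exists A; first by rewrite andbT.
  by apply/imfsetP; exists (c, d) => //=; rewrite finset.in_setT.
elim: i M a b => [|i IHi] M a b; first exact: XE.
move=> /imfset2P[A /= Ai [B /= BX ->]]; rewrite mxE.
have [|j _ ->] := @bipotent_sum S _ (index_enum 'I_n)
  (fun j => A a j * B j b) bipS.
  (* The row index [a] witnesses that there is at least one summand. *)
  by apply/eqP => enum0; have := mem_index_enum a; rewrite enum0.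
by apply/imfset2P; exists (A a j); [exact: IHi | exists (B j b); first exact: XE].
Qed.

(** The elements of [G] form a finite type, so [U] lies in the image under
[val] of the finite type of all matrices over it, which [card_mx] counts. *)
Lemma card_fset_mx (T : choiceType) (m n : nat) (G : {fset T})
    (U : {fset 'M[T]_(m, n)}) :
  (forall M, M \in U -> forall i j, M i j \in G) ->
  (#|` U| <= #|` G| ^ (m * n))%N.
Proof.
move=> UG; rewrite [#|` G|]cardfE -card_mx.
pose V := [fset map_mx val N | N in [set: 'M[G]_(m, n)]%SET]%fset.
apply: (@leq_trans #|` V|).
  apply: fsubset_leq_card; apply/fsubsetP => M MU.
  apply/imfsetP; exists (\matrix_(i, j) [` UG M MU i j]%fset).
    by rewrite /= finset.in_setT.
  by apply/matrixP => i j; rewrite !mxE.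
by apply: leq_trans (leq_imfset_card _ _ _) _; rewrite -cardE max_card.
Qed.

Lemma growth_mx_le (S : pzSemiRingType) (n : nat) (X : {fset 'M[S]_n})
    (k : nat) :
  bipotent S ->
  (growth (@GRing.mul 'M[S]_n) X k
     <= growth (@GRing.mul S) (fset_entries X) k ^ (n ^ 2))%N.
Proof.
move=> bipS; rewrite -mulnn; apply: card_fset_mx => M /growthP[i ik Mi] a b.
by apply/growthP; exists i => //; exact: products_entry.
Qed.

Theorem proposition6p1 (R : realType) (n : nat) (n_gt0 : (0 < n)%N)
    (S : pzSemiRingType) (S_bipotent : bipotent S)
    (X : {fset 'M[S]_n}) (t : nat) :
  poly_growth R (@GRing.mul S)
    (subsemigroup_gen (@GRing.mul S) (entries [set` X])) t ->
  poly_growth R (@GRing.mul 'M[S]_n)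
    (subsemigroup_gen (@GRing.mul 'M[S]_n) [set` X]) (t * n ^ 2)%N.
Proof.
rewrite fset_entriesE !poly_growthP => -[c c_gt0 growth_le].
exists (c ^+ (n ^ 2)) => [|k k_gt0]; first exact: exprn_gt0.
apply: (@le_trans _ _
  ((growth (@GRing.mul S) (fset_entries X) k)%:R ^+ (n ^ 2))).
  by rewrite -natrX ler_nat growth_mx_le.
rewrite exprM -exprMn.
apply: lerXn2r; rewrite ?nnegrE ?ler0n ?growth_le //.
by rewrite mulr_ge0 ?exprn_ge0 ?ler0n ?ltW.
Qed.
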